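(* Let $(\Omega,\mathcal{F},\mathbb{P})$ be a probability space and let $\mathcal{C}\subset \mathbb{L}^0_+$ be convex, max-closed and bounded, with $\mathcal{C}\cap \mathbb{L}^0_{++}\neq\emptyset$. Then $\mathcal{C}$ has at least one numéraire, i.e. $\mathcal{C}^{\mathsf{num}}\neq\emptyset$.
   Context: $\mathbb{L}^0$ is the set of all ($\mathbb{P}$-a.s. equivalence classes of) real-valued random variables on $(\Omega,\mathcal{F},\mathbb{P})$, with the topology induced by the metric $(f,g)\mapsto \mathbb{E}_{\mathbb{P}}[1\wedge|f-g|]$, i.e. convergence in probability. All relations between random variables are understood $\mathbb{P}$-a.s. $\mathbb{L}^0_+=\{f\in\mathbb{L}^0 : f\ge 0\}$ and $\mathbb{L}^0_{++}=\{f\in\mathbb{L}^0_+ : f>0\}$. For $\mathcal{C}\subseteq\mathbb{L}^0_+$, $\overline{\mathcal{C}}$ is its closure; $\mathcal{C}$ is bounded if $\lim_{\ell\to\infty}\sup_{f\in\mathcal{C}}\mathbb{P}[f>\ell]=0$. An element $f\in\mathcal{C}$ is maximal in $\mathcal{C}$ if $f\le g$ and $g\in\mathcal{C}$ imply $f=g$. $\mathcal{C}$ is max-closed if every maximal element of $\overline{\mathcal{C}}$ belongs to $\mathcal{C}$. For $\mathcal{C}$ with $\mathcal{C}\cap\mathbb{L}^0_{++}\ne\emptyset$, an element $g\in\mathcal{C}$ is a numéraire of $\mathcal{C}$ if $g\in\mathbb{L}^0_{++}$ and there exists a probability measure $\mathbb{Q}$ equivalent to $\mathbb{P}$ such that $\mathbb{E}_{\mathbb{Q}}[f/g]\le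 1$ for all $f\in\mathcal{C}$; $\mathcal{C}^{\mathsf{num}}$ is the set of all numéraires of $\mathcal{C}$. *)

(* Defs.v *)
From HB Require Import structures.
From mathcomp Require Import all_boot all_order all_algebra.
From mathcomp Require Import all_classical all_reals all_analysis.
From mathcomp Require Import measurable_realfun lra.

Set Implicit Arguments.
Unset Strict Implicit.
Unset Printing Implicit Defensive.
Import Order.TTheory GRing.Theory Num.Theory.
Import numFieldNormedType.Exports.

Local Open Scope classical_set_scope.
Local Open Scope ring_scope.
Local Open Scope quotient_scope.

(* Random variables up to P-a.s. equality.  An element is applied to a point
   through a representative chosen by the quotient, so only statements that are
   insensitive to P-null sets are meaningful *)
Definition L0 d (T : measurableType d) (R : realType) (P : probability T R) :
  Type := {mfun_ P, T >-> R}.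

Section L0_structures.
Context d (T : measurableType d) (R : realType) (P : probability T R).
Implicit Types (f g h : L0 P) (X Y : {mfun T >-> R}).

HB.instance Definition _ := Choice.on (L0 P).

Definition L0_repr f : {mfun T >-> R} :=
  repr (f : {mfun_ P, T >-> R}).

Definition L0_class X : L0 P :=
  \pi_({mfun_ P, T >-> R}) X.

Coercion L0_repr : L0 >-> MeasurableFun.type.

Lemma L0_eqP f g : f = g <-> \forall x \ae P, f x = g x.
Proof.
split=> [->|fg]; first exact: aeW.
rewrite -[f]reprK -[g]reprK; apply/eqmodP/asboolP.
by apply: filterS fg => x fgx _.
Qed.

Lemma L0_classE X : \forall x \ae P, L0_class X x = X x.
Proof.
have /eqmodP/asboolP : repr (L0_class X : {mfun_ P, T >-> R})
    = (X : {mfun T >-> R})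
    %[mod {mfun_ P, T >-> R}] by rewrite reprK.
by apply: filterS => x; exact.
Qed.

Definition L0_zero : L0 P := L0_class (0 : {mfun T >-> R}).
Definition L0_opp f : L0 P := L0_class (- (f : {mfun T >-> R})).
Definition L0_add f g : L0 P := L0_class ((f : {mfun T >-> R}) + g).
Definition L0_scale (a : R) f : L0 P := L0_class (a *: (f : {mfun T >-> R})).

Local Lemma zeroE : \forall x \ae P, L0_zero x = 0.
Proof. exact: L0_classE. Qed.
Local Lemma oppE f : \forall x \ae P, L0_opp f x = - f x.
Proof. exact: L0_classE. Qed.
Local Lemma addE f g : \forall x \ae P, L0_add f g x = f x + g x.
Proof. exact: L0_classE. Qed.
Local Lemma scaleE a f : \forall x \ae P, L0_scale a f x = a * f x.
Proof. exact: L0_classE. Qed.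

Local Lemma addA : associative L0_add.
Proof.
move=> f g h; apply/L0_eqP.
near=> x.
by rewrite (near (addE f _) x) // (near (addE g h) x) // (near (addE _ h) x) //
  (near (addE f g) x) // addrA.
Unshelve. all: by end_near. Qed.

Local Lemma addC : commutative L0_add.
Proof.
move=> f g; apply/L0_eqP; near=> x.
by rewrite (near (addE f _) x) // (near (addE g _) x) // addrC.
Unshelve. all: by end_near. Qed.

Local Lemma add0 : left_id L0_zero L0_add.
Proof.
move=> f; apply/L0_eqP; near=> x.
by rewrite (near (addE _ f) x) // (near zeroE x) // add0r.
Unshelve. all: by end_near. Qed.

Local Lemma addN : left_inverse L0_zero L0_opp L0_add.
Proof.
move=> f; apply/L0_eqP; near=> x.
by rewrite (near (addE _ f) x) // (near (oppE f) x) // (near zeroE x) // addNr.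
Unshelve. all: by end_near. Qed.

HB.instance Definition _ :=
  GRing.isZmodule.Build (L0 P) addA addC add0 addN.

Local Lemma scaleA a b f : L0_scale a (L0_scale b f) = L0_scale (a * b) f.
Proof.
apply/L0_eqP; near=> x.
by rewrite (near (scaleE a _) x) // (near (scaleE b f) x) //
  (near (scaleE (a * b) f) x) // mulrA.
Unshelve. all: by end_near. Qed.

Local Lemma scale1 : left_id 1 L0_scale.
Proof.
by move=> f; apply/L0_eqP; near=> x; rewrite (near (scaleE 1 f) x) // mul1r.
Unshelve. all: by end_near. Qed.

Local Lemma scaleDr : right_distributive L0_scale +%R.
Proof.
move=> a f g; apply/L0_eqP; near=> x.
by rewrite (near (scaleE a _) x) // (near (addE f g) x) //
  (near (addE (L0_scale a f) _) x) // (near (scaleE a f) x) //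
  (near (scaleE a g) x) // mulrDr.
Unshelve. all: by end_near. Qed.

Local Lemma scaleDl f : {morph L0_scale^~ f : a b / a + b}.
Proof.
move=> a b; apply/L0_eqP; near=> x.
by rewrite (near (scaleE (a + b) f) x) // (near (addE (L0_scale a f) _) x) //
  (near (scaleE a f) x) // (near (scaleE b f) x) // mulrDl.
Unshelve. all: by end_near. Qed.

HB.instance Definition _ :=
  GRing.Zmodule_isLmodule.Build R (L0 P) scaleA scale1 scaleDr scaleDl.

Lemma L0_0E : \forall x \ae P, (0 : L0 P) x = 0.
Proof. exact: zeroE. Qed.

Lemma L0_oppE f : \forall x \ae P, (- f : L0 P) x = - f x.
Proof. exact: oppE. Qed.

Lemma L0_addE f g : \forall x \ae P, (f + g : L0 P) x = f x + g x.
Proof. exact: addE. Qed.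

Lemma L0_scaleE a f : \forall x \ae P, (a *: f : L0 P) x = a * f x.
Proof. exact: scaleE. Qed.

Definition L0_dist f g : R := fine 'E_P[fun x => (Num.min 1 `|f x - g x|)%R]%E.

Local Lemma mdistR f g : measurable_fun setT (fun x => Num.min 1 `|f x - g x|).
Proof.
apply: measurable_minr; first exact: measurable_cst.
by apply: measurableT_comp => //; apply: measurable_funB.
Qed.

Local Lemma mdistE f g :
  measurable_fun setT (fun x => (Num.min 1 `|f x - g x|)%:E).
Proof. exact/measurable_EFinP/mdistR. Qed.

Local Lemma dist_ge0 f g x : 0 <= Num.min 1 `|f x - g x|.
Proof. by rewrite le_min ler01 normr_ge0. Qed.

Local Lemma distE_ge0 f g x : (0 <= (Num.min 1 `|f x - g x|)%:E)%E.
Proof. by rewrite lee_fin dist_ge0. Qed.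
#[local] Hint Resolve mdistE distE_ge0 : core.

Lemma L0_distE f g :
  (L0_dist f g)%:E = (\int[P]_x (Num.min 1 `|f x - g x|)%:E)%E.
Proof.
rewrite /L0_dist unlock fineK// ge0_fin_numE; last first.
  by apply: integral_ge0 => x ?; exact: distE_ge0.
apply: (@le_lt_trans _ _ (\int[P]_x (cst 1%:E x))%E).
  apply: ge0_le_integral => //.
  by move=> x ?; rewrite lee_fin ge_min lexx.
by rewrite integral_cst// mul1e [ltLHS]probability_setT ltry.
Qed.

Local Lemma distxx f : L0_dist f f = 0.
Proof.
apply: EFin_inj; rewrite L0_distE integral0_eq// => x _.
by rewrite subrr normr0 min_r.
Qed.

Local Lemma dist_eq0 f g : L0_dist f g = 0 -> f = g.
Proof.
move=> fg; apply/L0_eqP.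
have : (\int[P]_x `|(Num.min 1 `|f x - g x|)%:E| = 0)%E.
  rewrite -[RHS]/(0%:E) -fg L0_distE; apply: eq_integral => x ?.
  by rewrite gee0_abs.
move=> /(ae_eq_integral_abs _ measurableT (mdistE f g)).
apply: filterS => x /(_ I) [].
rewrite /Num.min; case: ifPn => _ /eqP; first by rewrite oner_eq0.
by rewrite normr_eq0 subr_eq0 => /eqP.
Qed.

Local Lemma dist_sym f g : L0_dist f g = L0_dist g f.
Proof. by rewrite /L0_dist; under eq_fun do rewrite distrC. Qed.

Local Lemma dist_triangle g f h : L0_dist f h <= L0_dist f g + L0_dist g h.
Proof.
rewrite -lee_fin EFinD !L0_distE -ge0_integralD//.
apply: ge0_le_integral => //; first exact: emeasurable_funD.
move=> x ?; rewrite -EFinD lee_fin.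
have := ler_distD (g x) (f x) (h x).
have := normr_ge0 (f x - g x); have := normr_ge0 (g x - h x).
move: `|_| `|_| `|_| => b a c a0 b0 cab.
by rewrite /Num.min; case: (ltP 1 a); case: (ltP 1 b); case: (ltP 1 c); lra.
Qed.

HB.instance Definition _ :=
  isMetric.Build R (L0 P) distxx dist_eq0 dist_sym dist_triangle.

End L0_structures.

Section numeraires.
Context d (T : measurableType d) (R : realType) (P : probability T R).
Implicit Types (f g : L0 P) (C : set (L0 P)).

Definition L0_nneg : set (L0 P) := [set f | \forall x \ae P, 0 <= f x].

Definition L0_pos : set (L0 P) :=
  L0_nneg `&` [set f | \forall x \ae P, 0 < f x].

(* Meant for nonempty C: the supremum of set0 in \bar R is -oo *)
Definition L0_bounded C :=
  ereal_sup [set P [set x | l < f x] | f in C] @[l --> +oo] --> 0%E.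

Definition L0_le f g := \forall x \ae P, f x <= g x.

Definition maximal C f := C f /\ forall g, L0_le f g -> C g -> f = g.

Definition max_closed C := maximal (closure C) `<=` C.

Definition equivalent_probability (Q : probability T R) := Q `<< P /\ P `<< Q.

(* Total division is harmless: g > 0 holds P-a.s., hence also Q-a.s. *)
Definition is_numeraire C g :=
  [/\ C g, L0_pos g & exists2 Q : probability T R, equivalent_probability Q &
    forall f, C f -> ('E_Q[fun x => (f x / g x)%R] <= 1)%E].

Definition numeraires C : set (L0 P) := [set g | is_numeraire C g].

End numeraires.

Arguments L0_nneg {d T R} P.
Arguments L0_pos {d T R} P.

(* Main.v *)
Require Import Defs.
From HB Require Import structures.
From mathcomp Require Import all_boot all_order all_algebra.
From mathcomp Require Import all_classical all_reals all_analysis.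
From mathcomp Require Import measurable_realfun lra ring.

Set Implicit Arguments.
Unset Strict Implicit.
Unset Printing Implicit Defensive.
Import Order.TTheory GRing.Theory Num.Theory.
Import numFieldNormedType.Exports.

Local Open Scope classical_set_scope.
Local Open Scope ring_scope.

(* A numeraire is obtained by maximizing the expected utility E[U(f)] over C,
   where U(x) = sqrt x / (1 + sqrt x) is bounded, strictly concave and has
   U'(0+) = +oo.  Strict concavity bounds E[(U(f) - U(f'))^2] by the utility gap
   of f and f', so U(f_n) converges a.s. along a fast maximizing sequence; since
   C is bounded the limit is < 1 a.s., whence f_n itself converges a.s., to some
   g in the closure of C.  E[U] is continuous in probability, so g also maximizes
   it over the closure; it is therefore a maximal element and lies in C.
   Differentiating along (1 - e) g + e f gives E[U'(g) f] <= E[U'(g) g] for f in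
   C by Fatou's lemma, while U'(0+) = +oo forces g > 0.  Hence
   dQ/dP = U'(g) g / E[U'(g) g] is the required change of measure. *)

(** * The utility function, its derivative and its inverse *)

Section utility.
Context {R : realType}.
Implicit Types x y s t e : R.

(** [Num.sqrt] vanishes on negative reals, so the bounds and the monotonicity of [util] hold on the
    whole line. *)
Definition util x : R := Num.sqrt x / (1 + Num.sqrt x).

(* The derivative of [util] on the positive reals *)
Definition dutil x : R := (2 * Num.sqrt x * (1 + Num.sqrt x) ^+ 2)^-1.

Definition util_inv (u : R) : R := u ^+ 2 / (1 - u) ^+ 2.

Lemma util_ge0 x : 0 <= util x.
Proof. by rewrite divr_ge0 ?addr_ge0 ?sqrtr_ge0. Qed.

Lemma util_lt1 x : util x < 1.
Proof.
have s0 := sqrtr_ge0 x.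
by rewrite ltr_pdivrMr ?mul1r ?ltrDr ?ltr01 //; apply: ltr_pwDl.
Qed.

Lemma util_le1 x : util x <= 1.
Proof. exact/ltW/util_lt1. Qed.

Lemma utilK x : 0 <= x -> util_inv (util x) = x.
Proof.
move=> x0; rewrite -[in RHS](sqr_sqrtr x0) /util_inv /util.
have s0 := sqrtr_ge0 x; field.
by rewrite lt0r_neq0 ?oner_neq0 ?addrK ?oner_eq0 //=; apply: ltr_pwDl.
Qed.

Lemma utilB x y : util y - util x =
  (Num.sqrt y - Num.sqrt x) / ((1 + Num.sqrt y) * (1 + Num.sqrt x)).
Proof.
have s0 := sqrtr_ge0 x; have t0 := sqrtr_ge0 y; rewrite /util.
by field; rewrite !lt0r_neq0 //; apply: ltr_pwDl.
Qed.

Lemma ler_util x y : x <= y -> util x <= util y.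
Proof.
move=> /ler_wsqrtr xy; rewrite -subr_ge0 utilB.
by rewrite divr_ge0 ?subr_ge0 ?mulr_ge0 ?addr_ge0 ?sqrtr_ge0.
Qed.

Lemma dutil_ge0 x : 0 <= dutil x.
Proof. by rewrite invr_ge0 !mulr_ge0 ?exprn_ge0 ?addr_ge0 ?sqrtr_ge0. Qed.

Lemma dutil_gt0 x : 0 < x -> 0 < dutil x.
Proof.
move=> x0; have s0 : 0 < Num.sqrt x by rewrite sqrtr_gt0.
by rewrite invr_gt0 !mulr_gt0 // exprn_gt0 // addr_gt0.
Qed.

(* Strict concavity, with a gain measured in units of utility: unlike a modulus
   in x and y, it is uniform on the whole half-line *)
Lemma util_tangent x y : 0 < x -> 0 <= y ->
  util y + (util y - util x) ^+ 2 <= util x + dutil x * (y - x).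
Proof.
move=> x0 y0; rewrite /util /dutil.
rewrite -{5}(sqr_sqrtr y0) -{7}(sqr_sqrtr (ltW x0)).
have : 0 < Num.sqrt x by rewrite sqrtr_gt0.
have := sqrtr_ge0 y.
move: (Num.sqrt x) (Num.sqrt y) => r t t0 r0; rewrite -subr_ge0.
(* With [r] and [t] the square roots of [x] and [y], the gap is [(t - r) ^+ 2] times a nonnegative
   quotient. *)
have -> : r / (1 + r) + (2 * r * (1 + r) ^+ 2)^-1 * (t ^+ 2 - r ^+ 2) -
  (t / (1 + t) + (t / (1 + t) - r / (1 + r)) ^+ 2) =
  (t - r) ^+ 2 * ((1 + t) ^+ 2 + 2 * r * t) /
    (2 * r * (1 + r) ^+ 2 * (1 + t) ^+ 2).
  by field; rewrite !lt0r_neq0 //; lra.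
have rt0 : 0 <= 2 * r * t by rewrite !mulr_ge0 // ltW.
apply: divr_ge0; first by rewrite mulr_ge0 ?addr_ge0 ?sqr_ge0.
have r1 : 0 <= r by exact: ltW.
by rewrite !mulr_ge0 ?addr_ge0 ?exprn_ge0 ?addr_ge0.
Qed.

(** Adding the tangent bounds at the midpoint for [x] and for [y] cancels the linear terms; the two
    squared gains sum to at least half of [(util x - util y) ^+ 2]. *)
Lemma util_midpoint x y : 0 <= x -> 0 <= y ->
  (util x - util y) ^+ 2 / 4 + (util x + util y) / 2 <= util ((x + y) / 2).
Proof.
move=> x0 y0; have [m0|m0] := ltP 0 ((x + y) / 2); last first.
  have -> : x = 0 by lra. have -> : y = 0 by lra.
  have -> : (0 + 0) / 2 = 0 :> R by lra.
  rewrite subrr expr0n /=; lra.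
have := util_tangent m0 x0; have := util_tangent m0 y0.
set m := (x + y) / 2; have -> : y - m = - (x - m) by rewrite /m; lra.
move: (util m) (util x) (util y) (x - m) (dutil m) => c a b z e H1 H2.
have := sqr_ge0 (a + b - 2 * c); lra.
Qed.

(** [util] takes values in [0, 1) and varies no more than [Num.sqrt], which is 1/2-Hölder. The
    right-hand side is the integrand of [L0_dist], which ties expected utility to convergence in
    probability. *)
Lemma util_holder x y : 0 <= x -> 0 <= y ->
  (util x - util y) ^+ 2 <= Num.min 1 `|x - y|.
Proof.
wlog xy : x y / x <= y.
  move=> H x0 y0; case/orP: (le_total x y) => xy; first exact: H.
  by rewrite -sqrrN opprB distrC; exact: H.
move=> x0 y0; rewrite distrC ger0_norm ?subr_ge0 // le_min.
have ux := util_ge0 x; have uy := util_lt1 y; have uxy := ler_util xy.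
apply/andP; split; first by nra.
have st := ler_wsqrtr xy; have s0 := sqrtr_ge0 x.
have Dst : util y - util x <= Num.sqrt y - Num.sqrt x.
  have st0 : 1 <= (1 + Num.sqrt y) * (1 + Num.sqrt x).
    by apply: mulr_ege1; rewrite lerDl sqrtr_ge0.
  by rewrite utilB ler_pdivrMr ?(lt_le_trans ltr01) // ler_peMr ?subr_ge0.
rewrite -{2}(sqr_sqrtr y0) -{2}(sqr_sqrtr x0); nra.
Qed.

(** The derivative explodes at 0, but [x * dutil x] stays below 1; for the maximizer [g] this makes
    the weight [dutil (g x) * g x] integrable. *)
Lemma ler_dutil_util x : x * dutil x <= util x.
Proof.
have [x0|x0] := ltP 0 x; last first.
  by rewrite (le_trans _ (util_ge0 _)) // mulr_le0_ge0 ?dutil_ge0.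
rewrite /dutil /util -{1}(sqr_sqrtr (ltW x0)).
have : 0 < Num.sqrt x by rewrite sqrtr_gt0.
move: (Num.sqrt x) => s s0.
have -> : s ^+ 2 / (2 * s * (1 + s) ^+ 2) = s / (2 * (1 + s) ^+ 2).
  by field; rewrite !lt0r_neq0 //; lra.
by rewrite ler_pM2l // lef_pV2 ?posrE ?mulr_gt0 ?exprn_gt0 //; nra.
Qed.

(* Quantifies dutil (0+) = +oo: this is what forces a maximizer to be positive *)
Lemma dutil_scale e x : 0 < e -> e <= 1 -> 0 <= x ->
  x * dutil x <= e * (x * dutil (e ^+ 2 * x)).
Proof.
move=> e0 e1 x0'; have [->|x0] := eqVneq x 0; first by rewrite !(mul0r,mulr0).
have {x0 x0'}x0 : 0 < x by rewrite lt0r x0.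
rewrite mulrCA ler_pM2l // /dutil sqrtrM ?sqr_ge0 // sqrtr_sqr (gtr0_norm e0).
have : 0 < Num.sqrt x by rewrite sqrtr_gt0.
move: (Num.sqrt x) => s s0.
have -> : e / (2 * (e * s) * (1 + e * s) ^+ 2) = (2 * s * (1 + e * s) ^+ 2)^-1.
  by field; rewrite !lt0r_neq0 //; nra.
have es0 : 0 < e * s by rewrite mulr_gt0.
have ess : e * s <= s by rewrite ger_pMl.
rewrite lef_pV2 ?posrE ?mulr_gt0 ?exprn_gt0 //; try lra.
by rewrite ler_pM2l ?mulr_gt0 // ler_pXn2r // ?nnegrE; lra.
Qed.

Lemma dutil_cvg x (x_ : R^nat) : 0 < x -> x_ n @[n --> \oo] --> x ->
  dutil (x_ n) @[n --> \oo] --> dutil x.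
Proof.
move=> x0 xx; have s0 : 0 < Num.sqrt x by rewrite sqrtr_gt0.
have sx : Num.sqrt (x_ n) @[n --> \oo] --> Num.sqrt x.
  by apply: continuous_cvg => //; exact: sqrt_continuous.
apply: cvgV; first by rewrite !mulf_neq0 ?expf_neq0 // lt0r_neq0 // addr_gt0.
apply: cvgM; first by apply: cvgM => //; exact: cvg_cst.
by apply: cvgM; (apply: cvgD => //; exact: cvg_cst).
Qed.

Lemma util_inv_cvg (u : R) (u_ : R^nat) : u < 1 -> u_ n @[n --> \oo] --> u ->
  util_inv (u_ n) @[n --> \oo] --> util_inv u.
Proof.
move=> u1 uu.
have nz : 1 - u != 0 by rewrite subr_eq0 eq_sym lt_eqF.
apply: cvgM; first exact: cvgM.
apply: cvgV; first by rewrite expf_neq0.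
by apply: cvgM; (apply: cvgB => //; exact: cvg_cst).
Qed.

Lemma util_inv_ge0 (u : R) : 0 <= util_inv u.
Proof. by rewrite divr_ge0 ?sqr_ge0. Qed.

End utility.

(** * Measurability of the utility functions *)

Section utility_measurability.
Context d (T : measurableType d) (R : realType).
Implicit Type X : T -> R.

(** Multiplying [X] by the power -1 of its square reduces to a nonnegative base; where [X] vanishes
    both sides are 0. *)
Lemma measurable_funV X :
  measurable_fun [set: T] X -> measurable_fun [set: T] (fun x => (X x)^-1).
Proof.
move=> mX; rewrite (_ : (fun x => _) = fun x => X x * ((X x ^+ 2) `^ (- 1))).
  apply: measurable_funM => //; apply: measurableT_comp (measurable_powR _) _.
  exact: measurable_funX.
apply/funext => x; rewrite powR_inv1 ?sqr_ge0 //.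
have [->|X0] := eqVneq (X x) 0; first by rewrite invr0 mul0r.
by rewrite expr2 invfM mulrA mulfV // mul1r.
Qed.

Lemma measurable_fun_sqrt X : measurable_fun [set: T] X ->
  measurable_fun [set: T] (fun x => Num.sqrt (X x)).
Proof.
move=> mX; apply: measurableT_comp mX.
apply: continuous_measurable_fun; exact: sqrt_continuous.
Qed.

Lemma measurable_fun_util X : measurable_fun [set: T] X ->
  measurable_fun [set: T] (fun x => util (X x)).
Proof.
move=> /measurable_fun_sqrt mX; apply: measurable_funM => //.
by apply: measurable_funV; exact: measurable_funD.
Qed.

Lemma measurable_fun_dutil X : measurable_fun [set: T] X ->
  measurable_fun [set: T] (fun x => dutil (X x)).
Proof.
move=> /measurable_fun_sqrt mX; apply: measurable_funV.
apply: measurable_funM; first exact: measurable_funM.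
by apply: measurable_funX; exact: measurable_funD.
Qed.

Lemma measurable_fun_util_inv X : measurable_fun [set: T] X ->
  measurable_fun [set: T] (fun x => util_inv (X x)).
Proof.
move=> mX; apply: measurable_funM; first exact: measurable_funX.
by apply: measurable_funV; apply: measurable_funX; exact: measurable_funB.
Qed.

End utility_measurability.

(** * Fatou's lemma and almost everywhere convergence *)

Section almost_everywhere.
Context d (T : measurableType d) (R : realType).
Context (mu : {measure set T -> \bar R}).

Lemma limn_einf_ge0 (u : (\bar R)^nat) :
  (forall n, 0 <= u n)%E -> (0 <= limn_einf u)%E.
Proof.
move=> u0; rewrite limn_einf_lim; apply: lime_ge; first exact: is_cvg_einfs.
by apply: nearW => n; apply: le_ereal_inf_tmp => _ [m _ <-].
Qed.

(** Serves twice: to show that no mass of a limit escapes to infinity, and to pass to the limit in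
    the first-order condition. *)
Lemma fatou_le (F : nat -> T -> \bar R) (G : T -> \bar R) (c : \bar R) :
  (forall n, measurable_fun [set: T] (F n)) ->
  (forall n x, (0 <= F n x)%E) ->
  measurable_fun [set: T] G -> (forall x, (0 <= G x)%E) ->
  (\forall x \ae mu, (G x <= limn_einf (F^~ x))%E) ->
  (forall n, (\int[mu]_x F n x <= c)%E) ->
  (\int[mu]_x G x <= c)%E.
Proof.
move=> mF F0 mG G0 GF Fc.
have einfs_le (u : (\bar R)^nat) n : (einfs u n <= u n)%E.
  by apply: ereal_inf_lbound; exists n => //=.
apply: (@le_trans _ _ (\int[mu]_x limn_einf (F^~ x))%E).
  apply: ae_ge0_le_integral => //.
  - by move=> x _; exact: limn_einf_ge0.
  - rewrite (_ : (fun x => _) = (fun x => - limn_esup (fun n => - F n x))%E).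
      apply: measurableT_comp => //; apply: measurable_fun_limn_esup => // n.
      exact: measurableT_comp.
    apply/funext => x; rewrite -limn_einfN; congr limn_einf.
    by apply/funext => n /=; rewrite oppeK.
  - by apply: filterS GF => x.
apply: (le_trans (fatou mu measurableT mF _)); first by move=> n x _; exact: F0.
rewrite limn_einf_lim; apply: lime_le; first exact: is_cvg_einfs.
by apply: nearW => n; exact: le_trans (einfs_le _ n) _.
Qed.

(** The increments have summable integrals, so the series of their absolute values is integrable,
    hence finite almost everywhere; telescoping then gives convergence. *)
Lemma ae_is_cvgn (u : nat -> T -> R) (e : R) :
  (forall n, measurable_fun [set: T] (u n)) -> 0 <= e ->
  (forall n, \int[mu]_x `|u n.+1 x - u n x|%:E <= (e / (2 ^ n.+1)%:R)%:E)%E ->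
  \forall x \ae mu, cvgn (u^~ x).
Proof.
move=> mu_ e0 ue.
pose D n x := `|u n.+1 x - u n x|%:E.
have mD n : measurable_fun [set: T] (D n).
  by apply/measurable_EFinP/measurableT_comp => //; exact: measurable_funB.
have D0 n x : (0 <= D n x)%E by rewrite lee_fin normr_ge0.
have iD : mu.-integrable [set: T] (fun x => \sum_(0 <= n <oo) D n x)%E.
  apply/integrableP; split; first by apply: (@ge0_emeasurable_sum _ _ _ _ D xpredT) => //.
  under eq_integral do (rewrite gee0_abs; last by apply: nneseries_ge0).
  rewrite integral_nneseries //.
  apply: (@le_lt_trans _ _ e%:E); last exact: ltry.
  (* Applied to zero terms, [epsilon_trick] bounds the geometric sum of the [e / 2 ^ n.+1] by
     [e]. *)
  have A0 (n : nat) : (0 <= (cst 0 : (\bar R)^nat) n)%E by [].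
  have := epsilon_trick xpredT A0 e0; rewrite [X in (_ <= X + _)%E]eseries0 // add0e.
  apply: le_trans; apply: lee_nneseries => [n _ _|n _ /=].
    by apply: integral_ge0 => x _; exact: D0.
  by rewrite add0e; exact: ue.
apply: filterS (integrable_ae measurableT iD) => x /(_ I) fin.
have : cvgn (series (telescope (u^~ x))).
  apply: normed_cvg; apply: nnseries_is_cvg => [n|]; first exact: normr_ge0.
    by move: fin; rewrite fin_numElt => /andP[].
rewrite telescopeK => cv.
have -> : u^~ x = (fun n => (u n x - u 0 x) + u 0 x).
  by apply/funext => n; rewrite subrK.
by apply: is_cvgD => //; exact: is_cvg_cst.
Qed.

End almost_everywhere.

(** * Integrals of nonnegative real functions *)

Section nonnegative_integral.
Context d (T : measurableType d) (R : realType).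
Context (mu : {measure set T -> \bar R}).
Implicit Types X Y : T -> R.

Lemma ge0_integralD_EFin X Y :
  measurable_fun [set: T] X -> measurable_fun [set: T] Y ->
  (forall x, 0 <= X x) -> (forall x, 0 <= Y x) ->
  (\int[mu]_x (X x + Y x)%:E = \int[mu]_x (X x)%:E + \int[mu]_x (Y x)%:E)%E.
Proof.
move=> mX mY X0 Y0; under eq_integral do rewrite EFinD.
by apply: ge0_integralD => //; [move=> x _; rewrite lee_fin|exact/measurable_EFinP
  |move=> x _; rewrite lee_fin|exact/measurable_EFinP].
Qed.

Lemma ge0_integralZl_EFinM X (k : R) : 0 <= k ->
  measurable_fun [set: T] X -> (forall x, 0 <= X x) ->
  (\int[mu]_x (k * X x)%:E = k%:E * \int[mu]_x (X x)%:E)%E.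
Proof.
move=> k0 mX X0; under eq_integral do rewrite EFinM.
by apply: ge0_integralZl => //; [exact/measurable_EFinP|move=> x _; rewrite lee_fin].
Qed.

Lemma ae_le_integral_EFin X Y :
  measurable_fun [set: T] X -> measurable_fun [set: T] Y ->
  (forall x, 0 <= X x) -> (forall x, 0 <= Y x) ->
  (\forall x \ae mu, X x <= Y x) ->
  (\int[mu]_x (X x)%:E <= \int[mu]_x (Y x)%:E)%E.
Proof.
move=> mX mY X0 Y0 XY; apply: ae_ge0_le_integral => //.
- by move=> x _; rewrite lee_fin.
- exact/measurable_EFinP.
- by move=> x _; rewrite lee_fin.
- exact/measurable_EFinP.
- by apply: filterS XY => x; rewrite lee_fin.
Qed.

End nonnegative_integral.

(** * Convex combinations of random variables *)

Section convexity.
Context d (T : measurableType d) (R : realType) (P : probability T R).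

Lemma convex_setP (C : set (L0 P)) (f g : L0 P) (a : R) :
  convex_set C -> C f -> C g -> 0 <= a <= 1 -> C (a *: f + (1 - a) *: g).
Proof.
move=> cC Cf Cg /andP[a0 a1].
by have := cC f g (Itv01 a0 a1); rewrite !inE; apply.
Qed.

Lemma L0_convE (f g : L0 P) (a b : R) :
  \forall x \ae P, (a *: f + b *: g : L0 P) x = a * f x + b * g x.
Proof.
apply: filterS3 (L0_addE (a *: f) (b *: g)) (L0_scaleE a f) (L0_scaleE b g).
by move=> x -> -> ->.
Qed.

End convexity.

(** * Expected utility: continuity and strict concavity *)

Section expected_utility.
Context d (T : measurableType d) (R : realType) (P : probability T R).
Implicit Types (f g h : L0 P) (X Y : T -> R).

(** Taken on functions rather than on classes, so that it also applies to pointwise convex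
    combinations. *)
Definition eutil X : \bar R := (\int[P]_x (util (X x))%:E)%E.

Lemma integral_prob_cst (r : R) : (\int[P]_x r%:E = r%:E)%E.
Proof. by rewrite integral_cst // [X in (_ * X)%E]probability_setT mule1. Qed.

Lemma le_eutil X Y :
  measurable_fun [set: T] X -> measurable_fun [set: T] Y ->
  (\forall x \ae P, X x <= Y x) -> (eutil X <= eutil Y)%E.
Proof.
move=> mX mY XY; apply: ae_le_integral_EFin.
- exact: measurable_fun_util.
- exact: measurable_fun_util.
- by move=> x; exact: util_ge0.
- by move=> x; exact: util_ge0.
- by apply: filterS XY => x; exact: ler_util.
Qed.

Lemma eutil_ge0 X : (0 <= eutil X)%E.
Proof. by apply: integral_ge0 => x _; rewrite lee_fin util_ge0. Qed.

Lemma eutil_le1 X : measurable_fun [set: T] X -> (eutil X <= 1)%E.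
Proof.
move=> mX; rewrite -(integral_prob_cst 1); apply: ae_le_integral_EFin => //.
- exact: measurable_fun_util.
- by move=> x; exact: util_ge0.
- by apply: aeW => x; exact: util_le1.
Qed.

Lemma eutil_fin_num X : measurable_fun [set: T] X -> eutil X \is a fin_num.
Proof.
move=> mX; rewrite ge0_fin_numE ?eutil_ge0 //.
exact: le_lt_trans (eutil_le1 mX) (ltry _).
Qed.

(** Integrates [a - b <= e + (a - b) ^+ 2 / e], the square being bounded by [util_holder]: a
    distance of order [e ^+ 2] moves the expectation by order [e]. *)
Lemma eutil_holder f g (e : R) : 0 < e -> L0_nneg P f -> L0_nneg P g ->
  (eutil f <= eutil g + (e + L0_dist f g / e)%:E)%E.
Proof.
move=> e0 f0 g0.
pose D x := Num.min 1 `|f x - g x|.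
have mf : measurable_fun [set: T] f by [].
have mg : measurable_fun [set: T] g by [].
have mD : measurable_fun [set: T] D.
  apply: measurable_minr => //.
  by apply: measurableT_comp => //; exact: measurable_funB.
have D0 x : 0 <= D x by rewrite le_min ler01 normr_ge0.
have muf := measurable_fun_util mf; have mug := measurable_fun_util mg.
rewrite EFinD; have -> : (L0_dist f g / e)%:E = (\int[P]_x (e^-1 * D x)%:E)%E.
  by rewrite ge0_integralZl_EFinM ?invr_ge0 ?ltW // -L0_distE -EFinM mulrC.
rewrite -(integral_prob_cst e).
have eD x : 0 <= e^-1 * D x by rewrite mulr_ge0 // invr_ge0 ltW.
have meD : measurable_fun [set: T] (fun x => e^-1 * D x) by exact: measurable_funM.
rewrite -ge0_integralD_EFin //; last by move=> x; exact: ltW.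
have eeD x : 0 <= e + e^-1 * D x by rewrite addr_ge0 // ltW.
have meeD : measurable_fun [set: T] (fun x => e + e^-1 * D x).
  exact: measurable_funD.
rewrite -ge0_integralD_EFin //; last by move=> x; exact: util_ge0.
apply: ae_le_integral_EFin => //.
- exact: measurable_funD.
- by move=> x; exact: util_ge0.
- by move=> x; rewrite addr_ge0 ?util_ge0.
apply: filterS2 f0 g0 => x f0 g0.
have := util_holder f0 g0; rewrite -/(D x).
move: (D x) (util _) (util _) => z a b abz.
have -> : e + e^-1 * z = (e ^+ 2 + z) / e by field; exact: lt0r_neq0.
rewrite -lerBlDl ler_pdivlMr //.
have := sqr_ge0 (a - b - e); have := sqr_ge0 e; have := sqr_ge0 (a - b).
nra.
Qed.

(** The concavity gain at the midpoint [h] has expectation at most [e ^+ 2], so the squared utility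
    difference has expectation at most [4 * e ^+ 2]; the pointwise bound [e * D <= e ^+ 2 + D ^+ 2]
    then yields the constant 5. *)
Lemma integral_util_diff_le f g h (e S : R) : 0 < e ->
  L0_nneg P f -> L0_nneg P g -> (\forall x \ae P, h x = (f x + g x) / 2) ->
  ((S - e ^+ 2)%:E <= eutil f)%E -> ((S - e ^+ 2)%:E <= eutil g)%E ->
  (eutil h <= S%:E)%E ->
  (\int[P]_x `|util (g x) - util (f x)|%:E <= (5 * e)%:E)%E.
Proof.
move=> e0 f0 g0 hfg.
have mf : measurable_fun [set: T] f by [].
have mg : measurable_fun [set: T] g by [].
have mh : measurable_fun [set: T] h by [].
have muf := measurable_fun_util mf; have mug := measurable_fun_util mg.
have muh := measurable_fun_util mh.
pose D x := `|util (g x) - util (f x)|.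
have mD : measurable_fun [set: T] D.
  by apply: measurableT_comp => //; exact: measurable_funB.
have D0 x : 0 <= D x by exact: normr_ge0.
have uf0 x : 0 <= util (f x) by exact: util_ge0.
have ug0 x : 0 <= util (g x) by exact: util_ge0.
have uh0 x : 0 <= util (h x) by exact: util_ge0.
(* Sums are compared rather than differences, so that all integrands are nonnegative. *)
have : (\int[P]_x (e * D x + (2 * util (f x) + 2 * util (g x)))%:E <=
        \int[P]_x (e ^+ 2 + 4 * util (h x))%:E)%E.
  apply: ae_le_integral_EFin.
  - by repeat (apply: measurable_funD || apply: measurable_funM => //).
  - by repeat (apply: measurable_funD || apply: measurable_funM => //).
  - by move=> x; rewrite !addr_ge0 ?mulr_ge0 // ltW.
  - by move=> x; rewrite !addr_ge0 ?mulr_ge0 // ltW // exprn_gt0.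
  apply: filterS3 f0 g0 hfg => x f0 g0 ->.
  have := util_midpoint f0 g0; rewrite /D.
  move: (util _) (util (f x)) (util (g x)) => c a b abc.
  have := sqr_ge0 (a - b); have := sqr_ge0 e.
  by case: (ler0P (b - a)) => ? ? ?; [have := sqr_ge0 (b - a + e)|
    have := sqr_ge0 (b - a - e)]; nra.
rewrite ge0_integralD_EFin //; first last.
- by move=> x; rewrite addr_ge0 ?mulr_ge0.
- by move=> x; rewrite mulr_ge0 // ltW.
- by apply: measurable_funD; exact: measurable_funM.
- exact: measurable_funM.
rewrite [X in (_ + X <= _)%E]ge0_integralD_EFin //; first last.
- by move=> x; rewrite mulr_ge0.
- by move=> x; rewrite mulr_ge0.
- exact: measurable_funM.
- exact: measurable_funM.
rewrite ge0_integralD_EFin //; first last.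
- by move=> x; rewrite mulr_ge0.
- by move=> x; rewrite sqr_ge0.
- exact: measurable_funM.
rewrite integral_prob_cst (ge0_integralZl_EFinM _ (ltW e0)) //.
rewrite !(@ge0_integralZl_EFinM _ _ _ _ _ 2) // (@ge0_integralZl_EFinM _ _ _ _ _ 4) //.
rewrite -!/(eutil _).
rewrite -(fineK (eutil_fin_num mf)) -(fineK (eutil_fin_num mg)).
rewrite -(fineK (eutil_fin_num mh)) !lee_fin.
move: (fine _) (fine _) (fine _) => a b c.
have : (0 <= \int[P]_x (D x)%:E)%E by apply: integral_ge0 => x _; rewrite lee_fin.
case: (\int[P]_x (D x)%:E)%E => [r| |]; last by [].
- rewrite -!EFinM -!EFinD !lee_fin => r0 H Ha Hb Hc.
  by rewrite -(ler_pM2l e0); nra.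
- by rewrite mulry gtr0_sg // mul1e.
Qed.

End expected_utility.

(** * Closure, almost sure limits and boundedness *)

Section closure.
Context d (T : measurableType d) (R : realType) (P : probability T R).
Implicit Types (f g h k : L0 P) (C : set (L0 P)).

Lemma L0_exists (X : T -> R) : measurable_fun [set: T] X ->
  exists f : L0 P, \forall x \ae P, f x = X x.
Proof.
move=> mX.
pose X' : {mfun T >-> R} := HB.pack X (isMeasurableFun.Build _ _ _ _ X mX).
by exists (L0_class P X'); exact: L0_classE.
Qed.

Lemma L0_closureP C g :
  closure C g <-> forall e : R, 0 < e -> exists2 f, C f & L0_dist g f < e.
Proof.
split=> [Cg e e0|H].
  by have [f [Cf gf]] := Cg _ (nbhsx_ballx g e e0); exists f.
move=> B /nbhs_ballP[e /= e0 eB].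
by have [f Cf gf] := H e e0; exists f; split => //; exact: eB.
Qed.

Lemma ae_cvg_dist (f_ : nat -> L0 P) g :
  (\forall x \ae P, f_ n x @[n --> \oo] --> g x) ->
  L0_dist g (f_ n) @[n --> \oo] --> (0 : R).
Proof.
move=> fg.
have mD n : measurable_fun [set: T] (fun x => (Num.min 1 `|g x - f_ n x|)%:E).
  apply/measurable_EFinP; apply: measurable_minr => //.
  by apply: measurableT_comp => //; exact: measurable_funB.
have [||||_ _] := @dominated_convergence _ _ _ P _ measurableT
  (fun n x => (Num.min 1 `|g x - f_ n x|)%:E) (cst 0%E) (cst 1%E) mD.
- exact: measurable_cst.
- apply: filterS fg => x fx _; apply: cvg_EFin; first exact: nearW.
  apply: (@squeeze_cvgr _ _ _ _ (cst 0) (fun n => `|g x - f_ n x|)).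
  + by apply: nearW => n /=; rewrite le_min ler01 normr_ge0 ge_min lexx orbT.
  + exact: cvg_cst.
  + rewrite -[X in _ --> X](normr0 R) -(subrr (g x)).
    by apply: cvg_norm; apply: cvgB => //; exact: cvg_cst.
- exact: finite_measure_integrable_cst.
- apply: aeW => x n _.
  by rewrite lee_fin ger0_norm ?ge_min ?lexx // le_min ler01 normr_ge0.
rewrite integral0 => /fine_cvg; apply: cvg_trans; apply: near_eq_cvg.
by apply: nearW => n; rewrite /= -L0_distE.
Qed.

(** Utility 1 stands for an infinite value. Where [1 <= u x], the [f_ n] eventually exceed any level
    [l], so Fatou's lemma bounds the probability of this set by the tail of [C] at [l], which is
    arbitrarily small. *)
Lemma bounded_lt1 C (f_ : nat -> L0 P) (u : T -> R) :
  L0_bounded C -> (forall n, C (f_ n)) -> measurable_fun [set: T] u ->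
  (\forall x \ae P, util (f_ n x) @[n --> \oo] --> u x) ->
  \forall x \ae P, u x < 1.
Proof.
move=> bC Cf mu uu.
pose A := [set x | 1 <= u x].
have mA : measurable A.
  by rewrite -[A]setTI; exact: measurable_fun_le.
have PA (e : R) : 0 < e -> (P A <= e%:E)%E.
  move=> e0.
  have [l Hl] : exists l : R, (ereal_sup [set P [set x | (l < f x)%R] | f in C] < e%:E)%E.
    have e0' : (0 < e%:E :> \bar R)%E by rewrite lte_fin.
    have [M [_ HM]] := bC _ (open_ereal_lt' e0').
    by exists (M + 1); apply: HM; rewrite ltrDl.
  pose B n := [set x | l < f_ n x].
  have mB n : measurable (B n).
    rewrite (_ : B n = ~` [set x | f_ n x <= l]); last first.
      by apply/seteqP; split => x /=; rewrite /B /= ltNge => /negP.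
    by apply: measurableC; rewrite -[X in measurable X]setTI; exact: measurable_fun_le.
  rewrite -[A]setIT -integral_indic //.
  apply: (@fatou_le _ _ _ P (fun n x => (\1_(B n) x)%:E)).
  - by move=> n; exact/measurable_EFinP/measurable_indic.
  - by move=> n x; rewrite lee_fin.
  - exact/measurable_EFinP/measurable_indic.
  - by move=> x; rewrite lee_fin.
  - apply: filterS uu => x ux.
    have [Ax|nAx] := pselect (A x); last first.
      rewrite indicE memNset //; apply: limn_einf_ge0 => n.
      by rewrite lee_fin.
    rewrite indicE mem_set //.
    rewrite (_ : limn_einf _ = 1%E) //.
    have H : (\1_(B n) x)%:E @[n --> \oo] --> (1%:E : \bar R).
      apply: cvg_near_cst.
      have : \forall n \near \oo, util l < util (f_ n x).
        by apply: (cvgr_gt _ ux); exact: lt_le_trans (util_lt1 l) Ax.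
      apply: filterS => n ln; rewrite indicE mem_set // /B /=.
      by rewrite ltNge; apply: contraTN ln => /ler_util; rewrite -leNgt.
    by rewrite (cvg_limn_einf_sup H).
  - move=> n; rewrite integral_indic // setIT.
    apply: le_trans (ltW Hl); apply: ereal_sup_ubound.
    by exists (f_ n).
exists A; split => //.
  apply/eqP; rewrite eq_le measure_ge0 andbT.
  by apply/lee_addgt0Pr => e e0; rewrite add0e PA.
by move=> x /= /negP; rewrite -leNgt.
Qed.

Lemma maximizing_sequence_cvg C (S : R) (f_ : nat -> L0 P) :
  C `<=` L0_nneg P -> convex_set C -> L0_bounded C ->
  (forall f, C f -> (eutil P f <= S%:E)%E) -> (forall n, C (f_ n)) ->
  (forall n, ((S - ((2 ^ n.+1)%:R^-1) ^+ 2)%:E <= eutil P (f_ n))%E) ->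
  exists2 g : L0 P, L0_nneg P g &
    \forall x \ae P, f_ n x @[n --> \oo] --> g x.
Proof.
move=> C0 cC bC CS Cf fS.
have muf n : measurable_fun [set: T] (fun x => util (f_ n x)).
  exact: measurable_fun_util.
have cu : \forall x \ae P, cvgn (fun n => util (f_ n x)).
  (* Both [f_ n] and [f_ n.+1] are within [e ^+ 2] of [S] for [e] the inverse of [2 ^ n.+1], so the
     increment is at most [5 * e]. *)
  apply: (@ae_is_cvgn _ _ _ P (fun n x => util (f_ n x)) 5 muf) => // n.
  have e0 : 0 < (2 ^ n.+1)%:R^-1 :> R by rewrite invr_gt0 ltr0n expn_gt0.
  pose h := 2^-1 *: f_ n + (1 - 2^-1) *: f_ n.+1 : L0 P.
  have Ch : C h by apply: convex_setP => //; lra.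
  apply: (@integral_util_diff_le _ _ _ P (f_ n) (f_ n.+1) h _ S) => //.
  - exact: C0.
  - exact: C0.
  - apply: filterS (L0_convE (f_ n) (f_ n.+1) 2^-1 (1 - 2^-1)) => x ->; lra.
  - apply: le_trans (fS n.+1); rewrite lee_fin lerD2l lerN2.
    rewrite ler_pXn2r ?nnegrE ?invr_ge0 // lef_pV2 ?posrE ?ltr0n ?expn_gt0 //.
    by rewrite ler_nat leq_exp2l.
  - exact: CS.
(* The upper limit is measurable on the whole space and equals the limit wherever the latter
   exists. *)
pose u x := limn_sup (fun n => util (f_ n x)).
have mu : measurable_fun [set: T] u.
  apply: (@measurable_fun_limn_sup _ _ _ _ (fun n x => util (f_ n x))) => //.
    by move=> x _; exists 1 => _ [n _ <-]; exact: util_le1.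
  by move=> x _; exists 0 => _ [n _ <-]; exact: util_ge0.
have uu : \forall x \ae P, util (f_ n x) @[n --> \oo] --> u x.
  by apply: filterS cu => x cx; rewrite /u cvg_limn_supE.
have u1 := bounded_lt1 bC Cf mu uu.
have [g gE] := L0_exists (measurable_fun_util_inv mu).
exists g; first by apply: filterS gE => x ->; exact: util_inv_ge0.
have f0 : \forall x \ae P, forall n, 0 <= f_ n x.
  by apply/ae_foralln => n; exact: C0.
near=> x; rewrite (near gE x) //.
have /funext <- : (fun n => util_inv (util (f_ n x))) =1 (f_^~ x).
  by move=> n; rewrite utilK // (near f0 x).
by apply: util_inv_cvg; [rewrite (near u1 x)|exact: (near uu x)].
Unshelve. all: by end_near. Qed.

End closure.

(** * Probability measures given by a density *)

Section density.
Context d (T : measurableType d) (R : realType) (P : probability T R).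

Lemma ae_eq0_of_integral (X : T -> R) :
  measurable_fun [set: T] X -> (forall x, 0 <= X x) ->
  (\int[P]_x (X x)%:E <= 0)%E -> \forall x \ae P, X x = 0.
Proof.
move=> mX X0 iX.
have : (\int[P]_x `|(X x)%:E| = 0)%E.
  under eq_integral do rewrite gee0_abs ?lee_fin //.
  by apply/eqP; rewrite eq_le iX integral_ge0 // => x _; rewrite lee_fin.
move/(ae_eq_integral_abs P measurableT (proj2 (measurable_EFinP _ _) mX)).
by apply: filterS => x /(_ I) [].
Qed.

(** [Q] integrates [w] over events. The integral formula comes from the Radon-Nikodym derivative of
    [Q], which agrees with [w] almost surely because both have the same integral over every
    event. *)
Lemma exists_density (w : T -> R) : measurable_fun [set: T] w ->
  (forall x, 0 <= w x) -> (\forall x \ae P, 0 < w x) ->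
  (\int[P]_x (w x)%:E = 1)%E ->
  exists2 Q : probability T R, equivalent_probability P Q &
    forall X : T -> R, measurable_fun [set: T] X -> (forall x, 0 <= X x) ->
      (\int[Q]_x (X x)%:E = \int[P]_x (X x * w x)%:E)%E.
Proof.
move=> mw w0 wpos w1.
have mEw : measurable_fun [set: T] (fun x => (w x)%:E) by exact/measurable_EFinP.
have Ew0 x : (0 <= (w x)%:E)%E by rewrite lee_fin.
pose q (A : set T) : \bar R := (\int[P]_(x in A) (w x)%:E)%E.
have q0 : q set0 = 0%E by rewrite /q integral_set0.
have qge0 A : (0 <= q A)%E by exact: integral_ge0.
have qsa : semi_sigma_additive q by exact: semi_sigma_additive_nng_induced.
have qT : q setT = 1%E by [].
pose Qm := isMeasure.Build d T R q q0 qge0 qsa.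
pose Q0 : {measure set T -> \bar R} := HB.pack q Qm.
pose Q : probability T R := HB.pack q Qm (Measure_isProbability.Build d T R Q0 qT).
have QE A : Q A = (\int[P]_(x in A) (w x)%:E)%E by [].
have QP : Q `<< P.
  apply/null_content_dominatesP => A mA PA0; rewrite QE.
  by apply: null_set_integral => //; exact: measurable_funS mEw.
(* On a [Q]-null event [w] is almost surely 0 and also almost surely positive, so the event is
   [P]-null. *)
have PQ : P `<< Q.
  apply/null_content_dominatesP => A mA QA0.
  have : (\int[P]_(x in A) `|(w x)%:E| = 0)%E.
    by rewrite -[RHS]QA0; apply: eq_integral => x _; rewrite gee0_abs.
  move/(ae_eq_integral_abs P mA (measurable_funS measurableT (@subsetT _ _) mEw)).
  move=> wA; apply/eqP; rewrite eq_le measure_ge0 andbT.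
  have /negligibleP : P.-negligible A.
    apply: (negligibleS _ (filterI wA wpos)) => x Ax /= [] /(_ Ax) [] ->.
    by rewrite ltxx.
  by move=> ->.
exists Q => // X mX X0.
have mEX : measurable_fun [set: T] (fun x => (X x)%:E) by exact/measurable_EFinP.
rewrite -(Radon_Nikodym_SigmaFinite.change_of_variables QP) //.
have iRN := Radon_Nikodym_SigmaFinite.f_integrable QP.
have RNw : ae_eq P setT (Radon_Nikodym_SigmaFinite.f Q P) (fun x => (w x)%:E).
  apply: integral_ae_eq => // E _ mE.
  by rewrite -(Radon_Nikodym_SigmaFinite.f_integral QP mE).
apply: ae_eq_integral => //.
- apply: emeasurable_funM => //; exact: measurable_int iRN.
- by apply/measurable_EFinP; exact: measurable_funM.
- by apply: filterS RNw => x /(_ I) RNx _; rewrite /= RNx EFinM.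
Qed.

End density.

(** * Existence of a maximizer of expected utility *)

Section maximizer.
Context d (T : measurableType d) (R : realType) (P : probability T R).
Implicit Types (f g h k : L0 P) (C : set (L0 P)).

Lemma L0_distC f g : L0_dist f g = L0_dist g f.
Proof. exact: (metric_sym (f : L0 P) g). Qed.

Lemma eutil_closure_le C (S : R) k : C `<=` L0_nneg P ->
  (forall f, C f -> (eutil P f <= S%:E)%E) ->
  closure C k -> L0_nneg P k -> (eutil P k <= S%:E)%E.
Proof.
move=> C0 CS /L0_closureP Ck k0; apply/lee_addgt0Pr => e e0.
(* At distance below [(e / 2) ^+ 2], [eutil_holder] with parameter [e / 2] costs at most [e]. *)
have e20 : 0 < e / 2 by rewrite divr_gt0.
have [f Cf kf] := Ck _ (exprn_gt0 2 e20).
apply: (le_trans (eutil_holder e20 k0 (C0 _ Cf))).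
apply: leeD; first exact: CS.
rewrite lee_fin [leRHS]splitr lerD2l ler_pdivrMr // -expr2; exact: ltW.
Qed.

Lemma eutil_cvg_ge (S : R) (f_ : nat -> L0 P) g :
  (forall n, L0_nneg P (f_ n)) -> L0_nneg P g ->
  (forall n, ((S - ((2 ^ n.+1)%:R^-1) ^+ 2)%:E <= eutil P (f_ n))%E) ->
  L0_dist g (f_ n) @[n --> \oo] --> (0 : R) -> (S%:E <= eutil P g)%E.
Proof.
move=> f0 g0 fS fg; apply/lee_addgt0Pr => e e0.
(* One third of [e] absorbs the utility gap of [f_ n], the other two the error of [eutil_holder]. *)
have e30 : 0 < e / 3 by rewrite divr_gt0.
have [n [n1 n2]] : exists n, L0_dist g (f_ n) < (e / 3) ^+ 2 /\
    ((2 ^ n.+1)%:R^-1) ^+ 2 <= e / 3 :> R.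
  have H1 : \forall n \near \oo, L0_dist g (f_ n) < (e / 3) ^+ 2.
    by apply: (cvgr_lt _ fg); rewrite exprn_gt0.
  have H2 := near_infty_natSinv_expn_lt (PosNum e30).
  have [n [h1 h2]] := filter_ex (filterI H1 H2).
  exists n; split => //; apply: le_trans (ltW h2) => /=.
  have a1 : 1 <= 2 ^+ n :> R by rewrite -natrX ler1n expn_gt0.
  rewrite div1r natrX (exprS 2) exprVn; move: (2 ^+ n) a1 => a a1.
  by rewrite lef_pV2 ?posrE ?exprn_gt0 ?mulr_gt0 ?(lt_le_trans ltr01) //; nra.
have := le_trans (fS n) (eutil_holder e30 (f0 n) g0).
rewrite -(fineK (eutil_fin_num P (X := g) _)) // -EFinD -EFinD !lee_fin L0_distC => H.
have : L0_dist g (f_ n) / (e / 3) <= e / 3 by rewrite ler_pdivrMr // -expr2 ltW.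
lra.
Qed.

(** Since [util] is monotone, the utilities of [f] and [g] agree almost surely, and [util_inv]
    recovers the values. Hence a maximizer over the closure is a maximal element. *)
Lemma eutil_le_eq f g : L0_nneg P f -> L0_le f g ->
  (eutil P g <= eutil P f)%E -> f = g.
Proof.
move=> f0 fg gf; apply/L0_eqP.
have mf : measurable_fun [set: T] f by [].
have mg : measurable_fun [set: T] g by [].
have muf := measurable_fun_util mf; have mug := measurable_fun_util mg.
pose D x := `|util (g x) - util (f x)|.
have mD : measurable_fun [set: T] D.
  by apply: measurableT_comp => //; exact: measurable_funB.
have : (\int[P]_x (D x)%:E <= 0)%E.
  rewrite -(leeD2lE (x := eutil P f)) ?eutil_fin_num // adde0.
  apply: le_trans gf; rewrite -ge0_integralD_EFin //; last 2 first.
  - by move=> x; exact: util_ge0.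
  - by move=> x; exact: normr_ge0.
  apply: ae_le_integral_EFin => //.
  - exact: measurable_funD.
  - by move=> x; rewrite addr_ge0 ?util_ge0 ?normr_ge0.
  - by move=> x; exact: util_ge0.
  apply: filterS fg => x /ler_util fgx.
  by rewrite /D ger0_norm ?subr_ge0 // addrC subrK.
move=> /(ae_eq0_of_integral mD (fun x => normr_ge0 _)).
apply: filterS3 f0 fg => x f0 fg /normr0_eq0/eqP.
by rewrite subr_eq0 => /eqP gfx; rewrite -(utilK f0) -(utilK (le_trans f0 fg)) gfx.
Qed.

Lemma exists_maximizer C :
  C `<=` L0_nneg P -> convex_set C -> max_closed C -> L0_bounded C ->
  C !=set0 -> exists2 g, C g & forall f, C f -> (eutil P f <= eutil P g)%E.
Proof.
move=> C0 cC mC bC [h Ch].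
have fu f : (fine (eutil P f))%:E = eutil P f by rewrite fineK // eutil_fin_num.
pose E := [set fine (eutil P f) | f in C]; pose S := sup E.
have supE : has_sup E.
  split; first by exists (fine (eutil P h)), h.
  by exists 1 => _ [f Cf <-]; rewrite -lee_fin fu eutil_le1.
have CS f : C f -> (eutil P f <= S%:E)%E.
  by move=> Cf; rewrite -fu lee_fin; apply: sup_upper_bound => //; exists f.
(* This precision is the rate at which the utility increments become summable. *)
have /choice[f_ f_P] : forall n : nat, exists f, C f /\
    ((S - ((2 ^ n.+1)%:R^-1) ^+ 2)%:E <= eutil P f)%E.
  move=> n; have n0 : 0 < ((2 ^ n.+1)%:R^-1) ^+ 2 :> R.
    by rewrite exprn_gt0 // invr_gt0 ltr0n expn_gt0.
  have [_ [f Cf <-] Sf] := sup_adherent n0 supE.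
  by exists f; split => //; rewrite -fu lee_fin ltW.
have Cf_ n : C (f_ n) by have [] := f_P n.
have fS n := proj2 (f_P n).
have [g g0 fg] := maximizing_sequence_cvg C0 cC bC CS Cf_ fS.
have dg := ae_cvg_dist fg.
have gS : (S%:E <= eutil P g)%E by apply: eutil_cvg_ge dg => // n; exact: C0.
have Cg : C g; last by exists g => // f /CS fS'; exact: le_trans gS.
(* Any [k] above [g] in the closure has expected utility at most [S], hence at most that of [g], so
   it equals [g]. *)
apply: mC; split.
  apply/L0_closureP => e e0.
  have [n gn] := filter_ex (cvgr_lt _ dg _ e0).
  by exists (f_ n).
move=> k gk Ck; apply: eutil_le_eq => //; apply: le_trans gS.
apply: eutil_closure_le Ck _ => //.
by apply: filterS2 g0 gk => x; exact: le_trans.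
Qed.

End maximizer.

(** * First-order condition at a maximizer *)

Section first_order.
Context d (T : measurableType d) (R : realType) (P : probability T R).
Context (C : set (L0 P)) (g : L0 P).
Context (C0 : C `<=` L0_nneg P) (cC : convex_set C) (Cg : C g).
Context (gmax : forall f, C f -> (eutil P f <= eutil P g)%E).

(* For e <= 1/2 the shifted marginal utility inside the absolute value is a.s.
   nonnegative, by [dutil_mul_le2] below *)
Let score (e : R) (f : L0 P) x : R :=
  `|dutil (e * f x + (1 - e) * g x) * (f x - g x) + 2|.

Let score_ge0 e f x : 0 <= score e f x.
Proof. exact: normr_ge0. Qed.

Let measurable_score e f : measurable_fun [set: T] (score e f).
Proof.
apply: measurableT_comp => //; apply: measurable_funD => //.
apply: measurable_funM; last exact: measurable_funB.
by apply/measurable_fun_dutil/measurable_funD; exact: measurable_funM.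
Qed.

(** As [b] has weight at least one half, [b <= 2 * m], while [m * dutil m <= util m < 1]. This
    explains the shift by 2 in [score]. *)
Lemma dutil_mul_le2 (a b e : R) : 0 <= a -> 0 <= b -> 0 <= e -> e <= 2^-1 ->
  dutil (e * a + (1 - e) * b) * b <= 2.
Proof.
move=> a0 b0 e0 e1; set m := e * a + (1 - e) * b.
have bm : b <= 2 * m by rewrite /m; nra.
have := ler_dutil_util m; have := util_lt1 m; have := dutil_ge0 m.
nra.
Qed.

(** The tangent at the mixture [m] bounds [util (g x)] by [util (m x) - e * dutil (m x) * (f x - g
    x)]. Since [g] maximizes, the directional term contributes nothing positive and only the shift
    remains. *)
Let integral_score_le f e : C f -> 0 < e -> e <= 2^-1 ->
  (\int[P]_x (score e f x)%:E <= 2%:E)%E.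
Proof.
move=> Cf e0 e1.
pose m x := e * f x + (1 - e) * g x.
have mm : measurable_fun [set: T] m.
  by apply: measurable_funD; exact: measurable_funM.
have mg : measurable_fun [set: T] g by [].
have mug := measurable_fun_util mg; have mum := measurable_fun_util mm.
have Jm : (eutil P m <= eutil P g)%E.
  pose k := e *: f + (1 - e) *: g : L0 P.
  have Ck : C k by apply: convex_setP => //; lra.
  apply: le_trans (gmax Ck); apply: le_eutil => //.
  by apply: filterS (L0_convE f g e (1 - e)) => x ->.
have : (\int[P]_x (util (g x) + e * score e f x)%:E <=
        \int[P]_x (util (m x) + e * 2)%:E)%E.
  apply: ae_le_integral_EFin.
  - by apply: measurable_funD => //; exact: measurable_funM.
  - exact: measurable_funD.
  - by move=> x; rewrite addr_ge0 ?util_ge0 // mulr_ge0 // ltW.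
  - by move=> x; rewrite addr_ge0 ?util_ge0 // mulr_ge0 // ltW.
  apply: filterS2 (C0 Cf) (C0 Cg) => x fx gx; rewrite /score -/(m x).
  have dg2 := dutil_mul_le2 fx gx (ltW e0) e1; rewrite -/(m x) in dg2.
  have df0 : 0 <= dutil (m x) * f x by rewrite mulr_ge0 ?dutil_ge0.
  rewrite ger0_norm; last by rewrite mulrBr; lra.
  have [m0|m0] := ltP 0 (m x).
    have := util_tangent m0 gx; have := sqr_ge0 (util (g x) - util (m x)).
    have -> : g x - m x = - (e * (f x - g x)) by rewrite /m; ring.
    nra.
  (* When the mixture vanishes so do [f x] and [g x], and the score reduces to its shift. *)
  have f00 : f x = 0 by move: m0; rewrite /m; nra.
  have g00 : g x = 0 by move: m0; rewrite /m; nra.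
  have := util_ge0 (m x); rewrite f00 g00 subrr mulr0 /util sqrtr0 mul0r; nra.
rewrite ge0_integralD_EFin //; first last.
- by move=> x; rewrite mulr_ge0 // ltW.
- by move=> x; exact: util_ge0.
- exact: measurable_funM.
rewrite [leRHS]ge0_integralD_EFin //; first last.
- by move=> x; rewrite mulr_ge0 // ltW.
- by move=> x; exact: util_ge0.
rewrite integral_prob_cst (ge0_integralZl_EFinM _ (ltW e0)) // -!/(eutil _ _).
move=> /le_trans /(_ (leeD2r (e * 2)%:E Jm)).
by rewrite leeD2lE ?eutil_fin_num // EFinM lee_pmul2l.
Qed.

(** Where [g] vanishes, giving [h] the weight [t ^+ 2] multiplies its marginal utility by at least
    [t^-1], yet the expected score stays at most 2. So the integral of [h x * dutil (h x)] over that
    set is at most [t * 2] for all small [t], and the set is null. *)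
Lemma maximizer_gt0 h : C h -> L0_pos P h -> \forall x \ae P, 0 < g x.
Proof.
move=> Ch [h0 hpos].
have mh : measurable_fun [set: T] h by [].
have mg : measurable_fun [set: T] g by [].
pose A := [set x | g x <= 0].
have mA : measurable A by rewrite -[A]setTI; exact: measurable_fun_le.
pose W x := \1_A x * `|h x * dutil (h x)|.
have mW : measurable_fun [set: T] W.
  apply: measurable_funM; first exact: measurable_indic.
  by apply: measurableT_comp => //; apply/measurable_funM/measurable_fun_dutil.
have W0 x : 0 <= W x by rewrite mulr_ge0.
have iW (t : R) : 0 < t -> t <= 2^-1 -> (\int[P]_x (W x)%:E <= (t * 2)%:E)%E.
  move=> t0 t1.
  have t20 : 0 < t ^+ 2 by rewrite exprn_gt0.
  have t21 : t ^+ 2 <= 2^-1 by nra.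
  apply: (@le_trans _ _ (\int[P]_x (t * score (t ^+ 2) h x)%:E)%E); last first.
    rewrite (ge0_integralZl_EFinM _ (ltW t0)) // EFinM lee_pmul2l //.
    exact: integral_score_le.
  apply: ae_le_integral_EFin => //.
  - exact: measurable_funM.
  - by move=> x; rewrite mulr_ge0 // ltW.
  apply: filterS2 h0 (C0 Cg) => x hx gx.
  have [Ax|nAx] := pselect (A x); last first.
    by rewrite /W indicE memNset // mul0r mulr_ge0 // ltW.
  have g0 : g x = 0 by apply/eqP; rewrite eq_le gx andbT.
  rewrite /W indicE mem_set // mul1r /score g0 mulr0 addr0 subr0.
  have hd0 : 0 <= h x * dutil (h x) by rewrite mulr_ge0 ?dutil_ge0.
  rewrite ger0_norm // (le_trans (dutil_scale t0 _ hx)) //; first by lra.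
  rewrite ler_pM2l // (le_trans _ (ler_norm _)) // mulrC; lra.
have W_eq0 : \forall x \ae P, W x = 0.
  apply: ae_eq0_of_integral => //; apply/lee_addgt0Pr => e e0; rewrite add0e.
  pose t := Num.min 2^-1 (e / 2).
  have t0 : 0 < t by rewrite lt_min invr_gt0 ltr0n divr_gt0.
  apply: le_trans (iW t t0 _) _; first by rewrite ge_min lexx.
  by rewrite lee_fin -ler_pdivlMr // ge_min lexx orbT.
apply: filterS3 hpos W_eq0 (C0 Cg) => x hx Wx gx.
rewrite lt_neqAle gx andbT eq_sym; apply/eqP => g0.
have Ax : A x by rewrite /A /= g0.
move: Wx; rewrite /W indicE mem_set // mul1r.
by apply/eqP; rewrite normr_eq0 mulf_neq0 ?gt_eqF // dutil_gt0.
Qed.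

(** The mixing weight tends to 0 in [integral_score_le], by Fatou's lemma. With [g] on the right,
    nonnegative integrals are compared instead of subtracting possibly infinite ones. *)
Lemma integral_dutil_le f : C f -> (\forall x \ae P, 0 < g x) ->
  (\int[P]_x (dutil (g x) * `|f x|)%:E <= \int[P]_x (dutil (g x) * `|g x|)%:E)%E.
Proof.
move=> Cf gpos.
have mf : measurable_fun [set: T] f by [].
have mg : measurable_fun [set: T] g by [].
have mdg := measurable_fun_dutil mg.
have dg0 x : 0 <= dutil (g x) by exact: dutil_ge0.
pose G x := score 0 f x.
have mG : measurable_fun [set: T] G by exact: measurable_score.
have iG : (\int[P]_x (G x)%:E <= 2%:E)%E.
  (* The weights start at one half, the largest value that [integral_score_le] admits. *)
  apply: (@fatou_le _ _ _ P (fun n x => (score (n.+2%:R^-1) f x)%:E)).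
  - by move=> n; exact/measurable_EFinP.
  - by move=> n x; rewrite lee_fin score_ge0.
  - exact/measurable_EFinP.
  - by move=> x; rewrite lee_fin score_ge0.
  - apply: filterS gpos => x gx.
    suff H : (score n.+2%:R^-1 f x)%:E @[n --> \oo] --> (G x)%:E.
      by rewrite (cvg_limn_einf_sup H).
    apply: cvg_EFin; first exact: nearW.
    have e0 : n.+2%:R^-1 @[n --> \oo] --> (0 : R).
      by rewrite (cvg_shiftS (fun n => n.+1%:R^-1 : R)); exact: cvg_harmonic.
    have cst_cvg (a : R) : a @[n --> \oo] --> a by exact: cvg_cst.
    apply: cvg_norm; apply: cvgD => //; apply: cvgM => //.
    apply: dutil_cvg; first by rewrite mul0r add0r subr0 mul1r.
    by apply: cvgD; apply: cvgM => //; exact: cvgB.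
  - move=> n; apply: integral_score_le => //.
    by rewrite lef_pV2 ?posrE // ler_nat.
have : (\int[P]_x (dutil (g x) * `|f x| + 2)%:E <=
        \int[P]_x (G x + dutil (g x) * `|g x|)%:E)%E.
  apply: ae_le_integral_EFin.
  - apply: measurable_funD => //; apply: measurable_funM => //.
    exact: measurableT_comp.
  - apply: measurable_funD => //; apply: measurable_funM => //.
    exact: measurableT_comp.
  - by move=> x; rewrite addr_ge0 // mulr_ge0.
  - by move=> x; rewrite addr_ge0 ?mulr_ge0 //; exact: score_ge0.
  apply: filterS2 (C0 Cf) (C0 Cg) => x fx gx.
  rewrite !ger0_norm // /G /score mul0r add0r subr0 mul1r.
  rewrite (le_trans _ (lerD (ler_norm _) (lexx _))) // mulrBr; lra.
rewrite ge0_integralD_EFin //; first last.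
- by move=> x; rewrite mulr_ge0.
- by apply: measurable_funM => //; exact: measurableT_comp.
rewrite integral_prob_cst ge0_integralD_EFin //; first last.
- by move=> x; rewrite mulr_ge0.
- by move=> x; exact: score_ge0.
- by apply: measurable_funM => //; exact: measurableT_comp.
move=> /le_trans /(_ (leeD2r _ iG)).
by rewrite [leRHS]addeC leeD2rE.
Qed.

End first_order.

(** * The numéraire and its change of measure *)

Theorem mainTheorem2 (d : measure_display) (T : measurableType d)
    (R : realType) (P : probability T R) (C : set (L0 P)) :
  C `<=` L0_nneg P ->
  convex_set C ->
  max_closed C ->
  L0_bounded C ->
  C `&` L0_pos P !=set0 ->
  numeraires C !=set0.
Proof.
move=> C0 cC mC bC [h [Ch hpos]].
have [g Cg gmax] : exists2 g, C g & forall f, C f -> (eutil P f <= eutil P g)%E.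
  by apply: exists_maximizer => //; exists h.
have gpos := maximizer_gt0 C0 cC Cg gmax Ch hpos.
have mg : measurable_fun [set: T] g by [].
have mdg := measurable_fun_dutil mg.
have mng : measurable_fun [set: T] (fun x => `|g x|) by exact: measurableT_comp.
(* The unnormalized density; the absolute value makes it nonnegative at every point, not only almost
   surely. *)
pose Y x := dutil (g x) * `|g x|.
have mY : measurable_fun [set: T] Y by exact: measurable_funM.
have Y0 x : 0 <= Y x by rewrite mulr_ge0 ?dutil_ge0.
have Ypos : \forall x \ae P, 0 < Y x.
  by apply: filterS gpos => x gx; rewrite mulr_gt0 ?dutil_gt0 ?normr_gt0 ?gt_eqF.
(* The mass is finite since [Y x <= util (g x) <= 1] almost surely; it is positive since otherwise
   [Y] would be both 0 and positive almost surely. *)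
have [c c0 cE] : exists2 c : R, 0 < c & (\int[P]_x (Y x)%:E = c%:E)%E.
  have I0 : (0 <= \int[P]_x (Y x)%:E)%E.
    by apply: integral_ge0 => x _; rewrite lee_fin.
  have I1 : (\int[P]_x (Y x)%:E <= 1)%E.
    rewrite -(integral_prob_cst P 1); apply: ae_le_integral_EFin => //.
    apply: filterS gpos => x gx; rewrite /Y gtr0_norm // mulrC.
    exact: le_trans (ler_dutil_util _) (util_le1 _).
  have Ifin : (\int[P]_x (Y x)%:E)%E \is a fin_num.
    by rewrite ge0_fin_numE // (le_lt_trans I1) // ltry.
  exists (fine (\int[P]_x (Y x)%:E)%E); last by rewrite fineK.
  rewrite fine_gt0 // (le_lt_trans I1 (ltry _)) andbT lt0e I0 andbT.
  apply/eqP => I00.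
  have Yz : \forall x \ae P, Y x = 0 by apply: ae_eq0_of_integral; rewrite ?I00.
  have : P.-negligible [set: T].
    apply: (negligibleS _ (filterI Yz Ypos)) => x _ /= [-> ]; by rewrite ltxx.
  move=> /(negligibleP P measurableT) PT0.
  by have := @probability_setT _ _ _ P; rewrite PT0 => /eqP; rewrite eqe eq_sym oner_eq0.
have ic0 : 0 <= c^-1 by rewrite invr_ge0 ltW.
have [|||| Q PQ QE] := @exists_density _ _ _ P (fun x => c^-1 * Y x).
- exact: measurable_funM.
- by move=> x; rewrite mulr_ge0.
- by apply: filterS Ypos => x Yx; rewrite mulr_gt0 ?invr_gt0.
- by rewrite ge0_integralZl_EFinM // cE -EFinM mulVf // gt_eqF.
have [QP _] := PQ.
exists g; split => //; first by split => //; exact: C0.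
exists Q => // f Cf; rewrite unlock.
have mf : measurable_fun [set: T] f by [].
have mnf : measurable_fun [set: T] (fun x => `|f x|) by exact: measurableT_comp.
have mX : measurable_fun [set: T] (fun x => `|f x| / `|g x|).
  by apply: measurable_funM => //; exact: measurable_funV.
have X0 x : 0 <= `|f x| / `|g x| by rewrite divr_ge0.
(* Almost sure facts pass from [P] to [Q] by domination; [QE] needs an integrand nonnegative
   everywhere. *)
have -> : (\int[Q]_x (f x / g x)%:E = \int[Q]_x (`|f x| / `|g x|)%:E)%E.
  apply: ae_eq_integral => //.
  - by apply/measurable_EFinP/measurable_funM => //; exact: measurable_funV.
  - exact/measurable_EFinP.
  apply: (null_dominates_ae_eq measurableT QP).
  apply: filterS2 gpos (C0 _ Cf) => x gx fx _.
  by rewrite ger0_norm // gtr0_norm.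
rewrite QE //.
(* The factor [|g x|] of the density cancels the denominator. *)
apply: (@le_trans _ _ (\int[P]_x (c^-1 * (dutil (g x) * `|f x|))%:E)%E).
  apply: ae_le_integral_EFin.
  - by apply: measurable_funM => //; exact: measurable_funM.
  - by apply: measurable_funM => //; exact: measurable_funM.
  - by move=> x; rewrite mulr_ge0 // mulr_ge0.
  - by move=> x; rewrite !mulr_ge0 ?dutil_ge0.
  apply: filterS gpos => x gx; rewrite /Y.
  have ng0 : `|g x| != 0 by rewrite normr_eq0 gt_eqF.
  by rewrite le_eqVlt; apply/orP; left; apply/eqP; field; rewrite ng0 gt_eqF.
rewrite ge0_integralZl_EFinM //; last first.
- by move=> x; rewrite mulr_ge0 ?dutil_ge0.
- exact: measurable_funM.
(* Since [c] is the integral of [Y], this form of 1 reduces the goal to the first-order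
   inequality. *)
have -> : (1 = c^-1%:E * c%:E :> \bar R)%E by rewrite -EFinM mulVf // gt_eqF.
by rewrite lee_pmul2l ?lte_fin ?invr_gt0 // -cE; exact: (integral_dutil_le C0 cC Cg gmax).
Qed.
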